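(* Let $A \in \mathcal M_d(\mathbb R)$, $p \in [1, +\infty)$, and let $\tau$ be a delay function such that $\inf_{s \in [0, t]} \tau(s) > 0$ for every $t \geq 0$. Write $\sigma_1(t) = t - \tau(t)$ for $t \in \mathbb R_+$ and assume that: $\tau$ is $(\mathfrak L, \mathfrak L)$-measurable; $\mathcal L(\sigma_1^{-1}(N)) = 0$ for every $N \in \mathfrak L$ with $\mathcal L(N) = 0$; and, for every $T > 0$, the Radon--Nikodym derivative of the measure $\left(\sigma_1\rvert_{[0, T]}\right)_{\#}\mathcal L$ with respect to $\mathcal L$ is bounded. Let $h$ be the largest delay function associated with $\tau$ and let $x_0 \in L^p(\lvert -h(0), 0], \mathbb R^d)$. Then there exists a unique $L^p$ solution $x \in L^p_{\mathrm{loc}}(\lvert -h(0), +\infty), \mathbb R^d)$ of $$x(t) = A x(t - \tau(t)), \qquad t \geq 0,$$ with initial condition $x_0$.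
   Context: $\mathbb R_+ = [0, +\infty)$, $\mathbb R_+^\ast = (0, +\infty)$; $\mathcal M_d(\mathbb R)$ is the set of real $d \times d$ matrices, $d$ a positive integer; $\mathfrak L$, $\mathfrak B$ are the Lebesgue and Borel $\sigma$-algebras and $\mathcal L$ is Lebesgue measure. A map $f\colon X \to Y$ is $(\mathfrak S_X, \mathfrak S_Y)$-measurable if $f^{-1}(B) \in \mathfrak S_X$ for all $B \in \mathfrak S_Y$; $f_\#\mu$ denotes the push-forward of the measure $\mu$ by $f$. Boundedness of a Radon--Nikodym derivative means membership in $L^\infty$. For $a \leq b$ in $\mathbb R \cup \{\pm\infty\}$, $\lvert a, b]$ denotes $[a, b]$ if $a > -\infty$ and $(a, b]$ if $a = -\infty$; $\lvert a, b)$ is defined similarly. A \emph{delay function} is any function $\tau\colon \mathbb R_+ \to \mathbb R_+^\ast$. Its \emph{largest delay function} is $h\colon \mathbb R_+ \to \mathbb R_+^\ast \cup \{+\infty\}$, $h(t) = t - \inf_{s \in [t, +\infty)} (s - \tau(s))$. An \emph{a.e. solution} is a function $x\colon \lvert -h(0), +\infty) \to \mathbb R^d$ such that, for every $\widetilde x\colon \lvert -h(0), +\infty) \to \mathbb R^d$ equal to $x$ a.e., we have $\widetilde x(t) = A \widetilde x(t - \tau(t))$ for a.e. $t \in \mathbb R_+$. An \emph{$L^p$ solution} is an $(\mathfrak L, \mathfrak B)$-measurable a.e. solution $x$ with $x \in L^p_{\mathrm{loc}}(\lvert -h(0), +\infty), \mathbb R^d)$. Its \emph{initial condition} is its restriction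 to $\lvert -h(0), 0)$. Equality with the initial condition and uniqueness are understood up to a.e. equality. *)

(* Defs.v *)
From HB Require Import structures.
From mathcomp Require Import all_boot all_order all_algebra.
From mathcomp Require Import all_classical all_reals all_analysis.

Set Implicit Arguments.
Unset Strict Implicit.
Unset Printing Implicit Defensive.

Import Order.TTheory GRing.Theory Num.Theory numFieldNormedType.Exports.

Local Open Scope classical_set_scope.
Local Open Scope ring_scope.

(* The carrier R with its Lebesgue (that is, Caratheodory-measurable) sets,
   as opposed to measurableTypeR R, which carries the Borel sets. *)
Notation lebesgueTypeR R :=
  (caratheodory_type ((@wlength R idfun)^*)%mu).

(* R^d with its Borel sets; the norm used on 'cV[R]_d is the library's maximum
   norm, which is equivalent to any other norm on R^d. *)
Notation borelTypeRd R d := (g_sigma_algebraType (@open 'cV[R]_d)).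

Section Intervals.
Context {R : realType}.

(* The real points of the interval from a to b. Only real points are collected,
   so the endpoint a is included exactly when it is finite, and likewise b in
   the closed case. *)
Definition itv_bar_o (a b : \bar R) : set R :=
  [set t | (a <= t%:E)%E /\ (t%:E < b)%E].

Definition itv_bar_c (a b : \bar R) : set R :=
  [set t | (a <= t%:E)%E /\ (t%:E <= b)%E].

End Intervals.

Section DelayFunctions.
Context {R : realType}.
Implicit Type tau : R -> R.

(* Functions on [0, +oo[ are represented by total functions whose values at
   negative arguments are irrelevant. *)
Definition delay_function tau := forall t, 0 <= t -> 0 < tau t.

Definition largest_delay tau (t : R) : \bar R :=
  (t%:E - ereal_inf [set (s - tau s)%:E | s in `[t, +oo[])%E.

Definition solution_domain tau : set R :=
  itv_bar_o (- largest_delay tau 0)%E +oo%E.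

Definition sigma1 tau (t : R) : R := t - tau t.

End DelayFunctions.

Section LebesgueSpaces.
Context {R : realType} {d : nat}.
Local Notation mu := (@completed_lebesgue_measure R).
Implicit Types (D : set R) (x : R -> 'cV[R]_d).

Definition LB_measurable D x :=
  measurable_fun (D : set (lebesgueTypeR R))
                 (x : lebesgueTypeR R -> borelTypeRd R d).

Definition in_Lp (p : R) D x :=
  LB_measurable D x /\
  (\int[mu]_(t in (D : set (lebesgueTypeR R))) (`|x t| `^ p)%:E < +oo)%E.

Definition in_Lploc (p : R) D x :=
  forall K : set R, compact K -> K `<=` D -> in_Lp p K x.

End LebesgueSpaces.

Section RadonNikodym.
Context {R : realType}.
Local Notation mu := (@completed_lebesgue_measure R).

(* The image measure of the restriction of f to D. *)
Definition pushforward_on (D : set R) (f : R -> R) :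
    set (lebesgueTypeR R) -> \bar R :=
  pushforward (fun E : set (lebesgueTypeR R) => mu (D `&` E))
              (f : lebesgueTypeR R -> lebesgueTypeR R).

(* The library's derivative takes a charge, hence the charge c that coincides
   with nu on Lebesgue sets; if c is not dominated by mu then Radon_Nikodym c mu
   is -oo everywhere and the predicate fails. *)
Definition bounded_RN_derivative (nu : set (lebesgueTypeR R) -> \bar R) :=
  exists c : {charge set (lebesgueTypeR R) -> \bar R},
    (forall B, measurable B -> c B = nu B) /\
    ('N[mu]_+oo [Radon_Nikodym c mu] < +oo)%E.

End RadonNikodym.

Section Solutions.
Context {R : realType} {d : nat}.
Local Notation mu := (@completed_lebesgue_measure R).
Implicit Types (A : 'M[R]_d) (tau : R -> R) (x : R -> 'cV[R]_d).

Definition ae_solution A tau x :=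
  forall y : R -> 'cV[R]_d,
    y = x %[ae mu in solution_domain tau] ->
    \forall t \ae mu, 0 <= t -> y t = A *m y (t - tau t).

Definition Lp_solution (p : R) A tau x :=
  [/\ LB_measurable (solution_domain tau) x,
      ae_solution A tau x &
      in_Lploc p (solution_domain tau) x].

Definition has_initial_condition tau x (x0 : R -> 'cV[R]_d) :=
  x = x0 %[ae mu in itv_bar_o (- largest_delay tau 0)%E 0%E].

End Solutions.

(* Main.v *)
Require Import Defs.
From HB Require Import structures.
From mathcomp Require Import all_boot all_order all_algebra.
From mathcomp Require Import all_classical all_reals all_analysis.
From mathcomp Require Import measurable_realfun ess_sup_inf.

(** On [0, T] the delay is bounded below by some delta > 0, so x on (-oo, t]
    determines x on (-oo, t + delta], up to T: iterating the map that sends x to x0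
    on the negative times and to A x(sigma_1) elsewhere stabilises pointwise
    on (-oo, T] after finitely many steps, and its limit satisfies the equation
    everywhere.  A bound M on the Radon-Nikodym derivative gives
    int_[0, T] |A x(sigma_1(t))|^p dt <= |A|^p M int_(-oo, T] |x|^p, so every
    iterate is p-integrable up to T; note that the integral reaches back to
    -h(0), which may be -oo, and this is where x0 in L^p of the whole initial
    interval is used.  Preimages of null sets under sigma_1 being null, a.e.
    equality propagates by the same steps of length delta. *)

Set Implicit Arguments.
Unset Strict Implicit.
Unset Printing Implicit Defensive.

Import Order.TTheory GRing.Theory Num.Theory numFieldNormedType.Exports.

Local Open Scope classical_set_scope.
Local Open Scope ring_scope.

(** * Measurability with respect to Lebesgue sets *)

Section LebesgueSets.
Context {R : realType}.
Local Notation L := (lebesgueTypeR R).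
Local Notation mu := (@completed_lebesgue_measure R).

Lemma borel_lebesgue_measurable (B : set R) :
  measurable (B : set (measurableTypeR R)) -> measurable (B : set L).
Proof. exact: sub_caratheodory. Qed.

Lemma borel_measurable_idfun :
  measurable_fun setT (idfun : L -> measurableTypeR R).
Proof. by move=> _ B mB; rewrite setTI; exact: borel_lebesgue_measurable. Qed.

(* A Lebesgue set is a Borel set up to a null set, so Borel measurability
   upgrades to Lebesgue measurability on the codomain. *)
Lemma measurable_fun_completed (D : set L) (f : L -> L) : measurable D ->
  measurable_fun D (f : L -> measurableTypeR R) ->
  (forall N : set L, measurable N -> mu N = 0%E ->
     mu (D `&` f @^-1` N) = 0%E) ->
  measurable_fun D f.
Proof.
move=> mD mf f0 _ E mE.
have [B mB [N [M [mM M0 NM]] BNE]] :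
    completed_algebra_gen (@lebesgue_measure R) E.
  by rewrite -g_sigma_completed_algebra_genE completed_caratheodory_measurable.
rewrite -BNE preimage_setU setIUr; apply: (@measurableU _ L); first exact: mf.
apply: completed_lebesgue_measure_is_complete.
have negM : mu.-negligible (D `&` f @^-1` M).
  have fM0 : mu (D `&` f @^-1` M) = 0%E.
    by apply: f0 => //; exact: borel_lebesgue_measurable.
  exists (D `&` f @^-1` M); split => //.
  (* [mu] is the restriction of the outer measure, so [fM0] says that this set has outer measure 0,
     which makes it Caratheodory measurable. *)
  apply: le_caratheodory_measurable => X /=.
  have -> : (wlength idfun)^*%mu (X `&` (D `&` f @^-1` M)) = 0%E.
    by apply/eqP; rewrite eq_le outer_measure_ge0 andbT -[leRHS]fM0;
       apply: le_outer_measure; exact: subIsetr.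
  by rewrite add0e; apply: le_outer_measure; exact: subIsetl.
apply: negligibleS negM => t [Dt Nt]; split => //; exact: NM.
Qed.

End LebesgueSets.

(** The image under [s] of [m1] restricted to [E] is a measure bounded by [M] times [m2], and
    integrals of nonnegative functions increase with the measure. *)
Lemma ge0_integral_comp_le d1 d2 (X : measurableType d1)
    (Y : measurableType d2) (R : realType) (m1 : {measure set X -> \bar R})
    (m2 : {measure set Y -> \bar R}) (E : set X) (s : X -> Y) (M : R)
    (f : Y -> \bar R) :
  measurable E -> measurable_fun E s -> 0 <= M ->
  (forall B, measurable B -> m1 (E `&` s @^-1` B) <= M%:E * m2 B)%E ->
  (forall y, 0 <= f y)%E -> measurable_fun setT f ->
  (\int[m1]_(x in E) f (s x) <= M%:E * \int[m2]_y f y)%E.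
Proof.
move=> mE ms M0 m12 f0 mf.
(* The image measure needs a map measurable on the whole space, so [s] is made constant off [E]. *)
pose s' x := if x \in E then s x else point.
have s'E x : E x -> s' x = s x by move=> Ex; rewrite /s' mem_set.
have ms' : measurable_fun setT s'.
  apply: measurable_fun_if => //.
  - apply: (measurable_fun_bool true); rewrite setTI.
    suff -> : mem E @^-1` [set true] = E by [].
    by apply/seteqP; split=> x /=; [exact: set_mem|exact: mem_set].
  - by apply: measurable_funS ms => // x [_ /=]; exact: set_mem.
have -> : (\int[m1]_(x in E) f (s x) =
    \int[mrestr m1 mE]_(x in E) f (s' x))%E.
  transitivity (\int[m1]_(x in E) f (s' x))%E.
    by apply: eq_integral => x /set_mem Ex; rewrite s'E.
  by apply: eq_measure_integral => A mA AE /=; rewrite /mrestr setIidl.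
have mfs' : measurable_fun setT (f \o s') by exact: measurableT_comp.
apply: (@le_trans _ _ (\int[mrestr m1 mE]_x f (s' x))%E).
  by apply: ge0_subset_integral.
have -> : (\int[mrestr m1 mE]_x f (s' x) =
    \int[pushforward (mrestr m1 mE) s']_y f y)%E.
  by rewrite ge0_integral_pushforward.
rewrite -(@ge0_integral_mscale _ _ _ m2 setT measurableT (NngNum M0))//.
apply: ge0_le_measure_integral => // B mB.
apply: le_trans (m12 B mB); rewrite /= /pushforward /mrestr setIC.
rewrite (_ : E `&` s' @^-1` B = E `&` s @^-1` B)//.
by apply/seteqP; split=> x [Ex /=]; rewrite s'E.
Qed.

(** * From a bounded Radon-Nikodym derivative to a bound on measures *)

Section RadonNikodymBound.
Context {R : realType}.
Local Notation L := (lebesgueTypeR R).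
Local Notation mu := (@completed_lebesgue_measure R).

(** The charge of a set is the integral of its density, whose absolute value is a.e. at most its
    essential supremum; the null-set condition provides the absolute continuity behind this
    formula. *)
Lemma bounded_RN_derivative_le (nu : set L -> \bar R) :
  (forall N, measurable N -> mu N = 0%E -> nu N = 0%E) ->
  bounded_RN_derivative nu ->
  exists2 M : R, 0 <= M &
    forall B, measurable B -> (nu B <= M%:E * mu B)%E.
Proof.
move=> nu0 [c [cnu]]; rewrite unlock.
(* The sup norm is the essential supremum only when [mu] is nonzero; in the other branch every set
   is null and the bound 0 works. *)
case: ifPn => [_ fin|]; last first.
  rewrite -leNgt => muT0 _; exists 0 => // B mB.
  rewrite mul0e nu0//; apply/eqP; rewrite -measure_le0 (le_trans _ muT0)//.
  by apply: le_measure; rewrite ?inE.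
have cmu : c `<< mu.
  by move=> N N0 A mA AN; rewrite cnu// nu0// N0.
set f := Radon_Nikodym c mu in fin.
have mf : measurable_fun setT f.
  exact: measurable_int (Radon_Nikodym_integrable cmu).
(* The absolute value gives [0 <= M] at once, and [M] bounds the essential supremum even were it
   -oo, where [fine] returns 0. *)
pose M : R := `|fine (ess_sup mu (abse \o f))|; exists M => [|B mB]; first exact: normr_ge0.
rewrite -cnu// (Radon_Nikodym_integral cmu mB).
apply: le_trans (lee_abs _) _.
apply: le_trans (le_abse_integral _ mB _) _; first exact: measurable_funS mf.
have <- : (\int[mu]_(t in B) (cst M%:E) t = M%:E * mu B)%E.
  exact: integral_cst.
apply: (ae_ge0_le_integral mB).
- by move=> t _; exact: abse_ge0.
- by apply: measurableT_comp => //; exact: measurable_funS mf.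
- by move=> t _; rewrite lee_fin normr_ge0.
- exact: measurable_cst.
- near=> t => _.
  have : (abse (f t) <= ess_sup mu (abse \o f))%E.
    by near: t; exact: ess_sup_ge.
  move=> /le_trans; apply.
  rewrite /cst /M; case: (ess_sup _ _) fin => [r _| |]//=; last by rewrite leNye.
  by rewrite lee_fin ler_norm.
Unshelve. all: by end_near. Qed.

End RadonNikodymBound.

(** * The norm and linear maps on R^d *)

Section BorelVectors.
Context {R : realType} {d : nat}.

Lemma continuous_borel_measurable (f : 'cV[R]_d -> 'cV[R]_d) : continuous f ->
  measurable_fun setT (f : borelTypeRd R d -> borelTypeRd R d).
Proof.
move=> cf; apply: (@measurability _ _ (borelTypeRd R d) (borelTypeRd R d) _ _
  (@open 'cV[R]_d)) => // _ [B oB <-].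
rewrite setTI; apply: sub_sigma_algebra.
by apply: open_comp => // x _; exact: cf.
Qed.

Lemma borel_measurable_norm : measurable_fun setT
  (fun v : borelTypeRd R d => `|v : 'cV[R]_d| : measurableTypeR R).
Proof.
apply: (measurability (@RGenOInfty.G R)); first exact: RGenOInfty.measurableE.
move=> _ [_ [r ->] <-]; rewrite setTI; apply: sub_sigma_algebra.
by apply: open_comp; [move=> x _; exact: norm_continuous|exact: interval_open].
Qed.

(** Each coordinate is bounded by its row sum times the maximum norm of [v]; the other rows only
    enlarge the constant. *)
Lemma mulmx_norm_le (A : 'M[R]_d) (v : 'cV[R]_d) :
  `|A *m v| <= (\sum_i \sum_j `|A i j|) * `|v|.
Proof.
have v_le j : `|v j 0| <= `|v|.
  by rewrite [leRHS]mx_normrE; exact: (le_bigmax _ _ (j, 0)).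
rewrite [leLHS]mx_normrE; apply/bigmax_leP; split => [|[i k] _ /=].
  by apply: mulr_ge0 => //; apply: sumr_ge0 => i _; exact: sumr_ge0.
rewrite mxE; apply: le_trans (ler_norm_sum _ _ _) _.
apply: (@le_trans _ _ ((\sum_j `|A i j|) * `|v|)).
  rewrite mulr_suml; apply: ler_sum => j _; rewrite normrM ord1.
  exact: ler_wpM2l.
apply: ler_wpM2r => //; rewrite [leRHS](bigD1 i)//= lerDl.
by apply: sumr_ge0 => l _; exact: sumr_ge0.
Qed.

Lemma mulmx_continuous (A : 'M[R]_d) :
  continuous (mulmx A : 'cV[R]_d -> 'cV[R]_d).
Proof.
apply: (@bounded_linear_continuous R 'cV[R]_d 'cV[R]_d (mulmx A)).
apply/ex_bound; exists (\sum_i \sum_j `|A i j|).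
near=> v; apply: le_trans (mulmx_norm_le A v) _; apply: ler_piMr.
  by apply: sumr_ge0 => i _; exact: sumr_ge0.
near: v; apply: (@nbhs0_le _ 'cV[R]_d); exact: ltr01.
Unshelve. all: by end_near. Qed.

End BorelVectors.

(** * Lp membership under restriction, union and composition *)

Section LpFunctions.
Context {R : realType} {d : nat}.
Local Notation L := (lebesgueTypeR R).
Local Notation mu := (@completed_lebesgue_measure R).
Implicit Types (p : R) (D E K : set L) (x y : R -> 'cV[R]_d).

Lemma LB_measurable_norm_powR p D x : LB_measurable D x ->
  measurable_fun D (fun t : L => (`|x t| `^ p)%:E).
Proof.
move=> mx; apply/measurable_EFinP.
apply: (measurableT_comp (measurable_powR p)).
exact: (measurableT_comp borel_measurable_norm mx).
Qed.

(** [x] pulls Borel sets back to Lebesgue sets only, so [s] must be measurable from Lebesgue sets to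
    Lebesgue sets. *)
Lemma LB_measurable_mulmx_comp (A : 'M[R]_d) D E x (s : L -> L) :
  measurable D -> LB_measurable D x -> measurable_fun E s ->
  s @` E `<=` D -> LB_measurable E (fun t => A *m x (s t)).
Proof.
move=> mD mx ms sED.
apply: (measurableT_comp (continuous_borel_measurable (@mulmx_continuous R d A))).
exact: (measurable_comp mD sED mx ms).
Qed.

Lemma eq_in_Lp p D x y : (forall t, D t -> x t = y t) ->
  in_Lp p D x -> in_Lp p D y.
Proof.
move=> xy [mx ix]; split.
  by apply: eq_measurable_fun mx => t /set_mem /xy.
rewrite (eq_integral (fun t : L => (`|x t| `^ p)%:E))// => t /set_mem /xy.
by move=> ->.
Qed.

Lemma in_LpS p D K x : measurable D -> measurable K -> K `<=` D ->
  in_Lp p D x -> in_Lp p K x.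
Proof.
move=> mD mK KD [mx ix]; split; first exact: measurable_funS mx.
apply: le_lt_trans ix; apply: (ge0_subset_integral mu mK mD _ _ KD).
- exact: LB_measurable_norm_powR.
- by move=> t _; rewrite lee_fin powR_ge0.
Qed.

Lemma in_LpU p D E x : measurable D -> measurable E -> [disjoint D & E] ->
  in_Lp p D x -> in_Lp p E x -> in_Lp p (D `|` E) x.
Proof.
move=> mD mE DE [mxD ixD] [mxE ixE].
have mx : LB_measurable (D `|` E) x by exact/measurable_funU.
split; first exact: mx.
rewrite (ge0_integral_setU mu mD mE _ _ DE).
- exact: lte_add_pinfty.
- exact: LB_measurable_norm_powR.
- by move=> t _; rewrite lee_fin powR_ge0.
Qed.

Lemma in_Lp0 p D : 0 < p -> in_Lp p D (fun=> 0 : 'cV[R]_d).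
Proof.
move=> p0; split; first exact: measurable_cst.
rewrite (eq_integral (cst 0%E)) ?integral0// => t _.
by rewrite normr0 powR0// gt_eqF.
Qed.

Lemma in_Lp_mulmx_comp p (A : 'M[R]_d) D E x (s : L -> L) (M : R) :
  0 <= p -> measurable D -> measurable E -> measurable_fun E s ->
  s @` E `<=` D -> 0 <= M ->
  (forall B, measurable B -> mu (E `&` s @^-1` B) <= M%:E * mu B)%E ->
  in_Lp p D x -> in_Lp p E (fun t => A *m x (s t)).
Proof.
move=> p0 mD mE ms sED M0 muM [mx ix].
have mAx : LB_measurable E (fun t => A *m x (s t)).
  exact: LB_measurable_mulmx_comp ms sED.
split; first exact: mAx.
set C := \sum_i \sum_j `|A i j|.
have C0 : 0 <= C by apply: sumr_ge0 => i _; exact: sumr_ge0.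
(* Extension by zero off [D] fits [ge0_integral_comp_le], which integrates over the whole line;
   nothing changes along [s], which maps [E] into [D]. *)
pose g : L -> \bar R := (fun t => (`|x t| `^ p)%:E) \_ D.
have g0 t : (0 <= g t)%E.
  by rewrite /g patchE; case: ifPn => // _; rewrite lee_fin powR_ge0.
have mg : measurable_fun setT g.
  apply/(measurable_restrictT _ mD); exact: LB_measurable_norm_powR.
have mgs : measurable_fun E (g \o s) by exact: (measurableT_comp mg).
have Cp0 : (0 <= (C `^ p)%:E)%E by rewrite lee_fin powR_ge0.
apply: (@le_lt_trans _ _ (\int[mu]_(t in E) ((C `^ p)%:E * g (s t)))%E).
  apply: (ge0_le_integral mu mE).
  - by move=> t _; rewrite lee_fin powR_ge0.
  - exact: LB_measurable_norm_powR.
  - exact: measurable_funeM.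
  - move=> t Et; rewrite /g patchE mem_set; last by apply: sED; exists t.
    rewrite -EFinM lee_fin -powRM//; apply: ge0_ler_powR => //.
    + by rewrite nnegrE.
    + by rewrite nnegrE mulr_ge0.
    + exact: mulmx_norm_le.
rewrite (ge0_integralZl mu mE mgs (fun t _ => g0 (s t)) Cp0).
apply: lte_mul_pinfty; [exact: Cp0|by []|].
apply: (le_lt_trans (ge0_integral_comp_le mE ms M0 muM g0 mg)).
apply: lte_mul_pinfty; [by rewrite lee_fin|by []|].
rewrite /g -integral_mkcond; exact: ix.
Qed.

End LpFunctions.

#[local] Instance ae_completed_lebesgue_measure_filter (R : realType) :
  Filter (nbhs (almost_everywhere (@completed_lebesgue_measure R))).
Proof. exact: (ae_filter_ringOfSetsType (@completed_lebesgue_measure R)). Qed.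

(** * The domain of solutions and the map [sigma1] *)

Section SolutionDomain.
Context {R : realType}.
Local Notation L := (lebesgueTypeR R).
Implicit Types tau : R -> R.

Lemma measurable_itv_bar_o (a b : \bar R) : measurable (itv_bar_o a b : set L).
Proof.
apply: borel_lebesgue_measurable.
rewrite (_ : itv_bar_o a b = setT `&` EFin @^-1` `[a, b[%classic).
  by apply: EFin_measurable => //; exact: emeasurable_itv.
rewrite setTI; apply/seteqP; split=> t /=; rewrite in_itv/=.
  by move=> [-> ->].
by move=> /andP[].
Qed.

Lemma measurable_itv_bar_c (a b : \bar R) : measurable (itv_bar_c a b : set L).
Proof.
apply: borel_lebesgue_measurable.
rewrite (_ : itv_bar_c a b = setT `&` EFin @^-1` `[a, b]%classic).
  by apply: EFin_measurable => //; exact: emeasurable_itv.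
rewrite setTI; apply/seteqP; split=> t /=; rewrite in_itv/=.
  by move=> [-> ->].
by move=> /andP[].
Qed.

Lemma itv_bar_o_solution_domain tau t :
  itv_bar_o (- largest_delay tau 0)%E 0%E t <-> solution_domain tau t /\ t < 0.
Proof.
rewrite /solution_domain /itv_bar_o /= lte_fin; split=> [[-> ->]|[[-> _] ->]//].
by rewrite ltry.
Qed.

(** The left end -h(0) is the infimum of s - tau(s) over s >= 0, and it belongs to the domain when
    finite. *)
Lemma sigma1_solution_domain tau t :
  0 <= t -> solution_domain tau (sigma1 tau t).
Proof.
move=> t0; split; last exact: ltry.
rewrite /largest_delay sub0e oppeK; apply: ereal_inf_lbound.
by exists t => //; rewrite /= in_itv/= t0.
Qed.

Lemma solution_domain_ge0 tau t :
  delay_function tau -> 0 <= t -> solution_domain tau t.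
Proof.
move=> tau0 t0; split; last exact: ltry.
have [h0 _] := sigma1_solution_domain tau (lexx 0).
apply: le_trans h0 _; rewrite lee_fin (le_trans _ t0)// /sigma1 sub0r oppr_le0.
exact/ltW/tau0.
Qed.

Lemma inf_delay_le tau T t : delay_function tau -> 0 <= t <= T ->
  inf (tau @` `[0, T]) <= tau t.
Proof.
move=> tau0 tT; apply: ge_inf; last by exists t => //; rewrite /= in_itv.
(* [inf] is a lower bound only for sets bounded below; positivity of the delay supplies the bound
   0. *)
by exists 0 => _ [s /= + <-]; rewrite in_itv/= => /andP[s0 _]; exact/ltW/tau0.
Qed.

(** Subtraction yields measurability towards Borel sets; the null-preimage condition lifts it to
    Lebesgue sets. *)
Lemma measurable_sigma1 tau :
  measurable_fun (`[0, +oo[%classic : set L) (tau : L -> L) ->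
  (forall N : set L, measurable N -> completed_lebesgue_measure N = 0%E ->
     completed_lebesgue_measure
       (`[0, +oo[ `&` sigma1 tau @^-1` N : set L) = 0%E) ->
  measurable_fun (`[0, +oo[%classic : set L) (sigma1 tau : L -> L).
Proof.
move=> mtau null.
have m0 : measurable (`[0, +oo[%classic : set L).
  by apply: borel_lebesgue_measurable; exact: measurable_itv.
apply: measurable_fun_completed => //.
apply: (@measurable_funB _ L R) => //.
  by apply: measurable_funS borel_measurable_idfun.
exact: (measurableT_comp borel_measurable_idfun mtau).
Qed.

(** The new exceptional set lies in the preimage under [sigma1] of the old one, which is null. *)
Lemma ae_sigma1 tau (P : R -> Prop) :
  (forall N : set L, measurable N -> completed_lebesgue_measure N = 0%E ->
     completed_lebesgue_measure
       (`[0, +oo[ `&` sigma1 tau @^-1` N : set L) = 0%E) ->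
  measurable_fun (`[0, +oo[%classic : set L) (sigma1 tau : L -> L) ->
  (\forall t \ae (@completed_lebesgue_measure R), P t) ->
  \forall t \ae (@completed_lebesgue_measure R), 0 <= t -> P (sigma1 tau t).
Proof.
move=> null ms [N [mN N0 PN]].
exists (`[0, +oo[ `&` sigma1 tau @^-1` N); split.
- apply: ms => //; apply: borel_lebesgue_measurable; exact: measurable_itv.
- exact: null.
- move=> t /= /not_implyP[t0 Pt]; split; first by rewrite /= in_itv/= t0.
  exact: PN.
Qed.

End SolutionDomain.

(** * The method of steps *)

Section MethodOfSteps.
Context {R : realType} {d : nat} (A : 'M[R]_d) (tau : R -> R)
  (x0 : R -> 'cV[R]_d).

(** Its fixed points satisfy the equation at every t >= 0 and equal [x0] at negative times. *)
Definition delay_step (x : R -> 'cV[R]_d) (t : R) : 'cV[R]_d :=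
  if t < 0 then x0 t else A *m x (sigma1 tau t).

Definition delay_iter (n : nat) : R -> 'cV[R]_d :=
  iter n delay_step (fun=> 0).

(* For t <= T, each step decreases t by at least inf tau over [0, T], hence
   reaches the negative times in fewer than delay_rank T steps. *)
Definition delay_rank (T : R) : nat :=
  (Num.trunc (T / inf (tau @` `[0, T]))).+2.

(** The pointwise limit of the iterates, read at an index where it is already reached; the absolute
    value serves as a nonnegative horizon above [t]. *)
Definition delay_solution (t : R) : 'cV[R]_d :=
  delay_iter (delay_rank `|t|) t.

(** Induction on [n]: at a negative time both sides are [x0 t]; otherwise both read the previous
    iterate at [sigma1 tau t], still at most [T] and smaller by at least the infimum. *)
Lemma delay_iter_stable T n m t : delay_function tau -> 0 <= T ->
  t <= T -> t < n%:R * inf (tau @` `[0, T]) -> (n <= m)%N ->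
  delay_iter m.+1 t = delay_iter n.+1 t.
Proof.
move=> tau0 T0; elim: n m t => [|n IH] [|m]//= t tT tn nm;
  rewrite {1 3}/delay_step; case: ltP => // t0.
  by move: tn; rewrite mul0r ltNge t0.
congr (_ *m _); apply: IH => //.
  by rewrite /sigma1 lerBlDr (le_trans tT)// lerDl ltW// tau0.
rewrite /sigma1 ltrBlDr (lt_le_trans tn)// -natr1 mulrDl mul1r lerD2l.
by apply: inf_delay_le => //; rewrite t0.
Qed.

Context (tau0 : delay_function tau).
Context (tau_inf : forall t, 0 <= t -> 0 < inf (tau @` `[0, t])).

Lemma delay_iter_rank T m t : 0 <= T -> t <= T -> (delay_rank T <= m)%N ->
  delay_iter m t = delay_iter (delay_rank T) t.
Proof.
(* One successor in [delay_rank] makes the multiple of the infimum exceed [T]; the other is the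
   index shift in [delay_iter_stable]. *)
case: m => // m T0 tT; rewrite ltnS => Tm; apply: (delay_iter_stable tau0 T0 tT _ Tm).
apply: le_lt_trans tT _; rewrite -ltr_pdivrMr ?tau_inf//.
exact: truncnS_gt.
Qed.

Lemma delay_solution_rank T m t : 0 <= T -> t <= T -> (delay_rank T <= m)%N ->
  delay_solution t = delay_iter m t.
Proof.
move=> T0 tT Tm; rewrite /delay_solution.
(* Index [k] is past the ranks of both horizons [|t|] and [T], so the two readings meet there. *)
set k := maxn (delay_rank `|t|) m.
rewrite -(@delay_iter_rank _ k) ?leq_maxl ?ler_norm//.
rewrite (@delay_iter_rank T k) ?(@delay_iter_rank T m)//.
exact: leq_trans Tm (leq_maxr _ _).
Qed.

Lemma delay_solution_lt0 t : t < 0 -> delay_solution t = x0 t.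
Proof.
move=> t0; rewrite (@delay_solution_rank 0 (delay_rank 0).+1)// ?ltW//=.
by rewrite /delay_step t0.
Qed.

Lemma delay_solution_ge0 t : 0 <= t ->
  delay_solution t = A *m delay_solution (sigma1 tau t).
Proof.
move=> t0; have st : sigma1 tau t <= t by rewrite gerBl ltW// tau0.
(* With the common horizon [t], the left side is read one iteration later than the right, so that
   one [delay_step] unfolds. *)
rewrite (@delay_solution_rank t (delay_rank t).+1)//.
rewrite [in RHS](@delay_solution_rank t (delay_rank t))//=.
by rewrite /delay_step ltNge t0.
Qed.

End MethodOfSteps.

(** * Existence and uniqueness of the solution *)

Section ExistenceUniqueness.
Context {R : realType} {d : nat} (A : 'M[R]_d) (tau : R -> R).
Local Notation L := (lebesgueTypeR R).
Local Notation mu := (@completed_lebesgue_measure R).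
Local Notation D := (solution_domain tau).
Context (tau0 : delay_function tau).
Context (tau_inf : forall t, 0 <= t -> 0 < inf (tau @` `[0, t])).
Context (null : forall N : set L, measurable N -> mu N = 0%E ->
  mu (`[0, +oo[ `&` sigma1 tau @^-1` N : set L) = 0%E).
Context (ms : measurable_fun (`[0, +oo[%classic : set L) (sigma1 tau : L -> L)).

Lemma delay_equation_ae_unique (x y : R -> 'cV[R]_d) :
  (\forall t \ae mu, 0 <= t -> x t = A *m x (sigma1 tau t)) ->
  (\forall t \ae mu, 0 <= t -> y t = A *m y (sigma1 tau t)) ->
  (\forall t \ae mu, D t -> t < 0 -> x t = y t) ->
  (\forall t \ae mu, D t -> x t = y t).
Proof.
move=> xA yA xy0.
have step T n : 0 <= T -> \forall t \ae mu, D t -> t <= T ->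
    t < n%:R * inf (tau @` `[0, T]) -> x t = y t.
  move=> T0; elim: n => [|n IH].
    apply: filterS xy0 => t + Dt _; rewrite mul0r => H t0; exact: H.
  have IHs := ae_sigma1 null ms IH.
  near=> t => Dt tT tn.
  have [t0|t0] := ltP t 0; first by move: Dt t0; near: t.
  have -> : x t = A *m x (sigma1 tau t) by move: t0; near: t.
  have -> : y t = A *m y (sigma1 tau t) by move: t0; near: t.
  congr (_ *m _).
  have xys : D (sigma1 tau t) -> sigma1 tau t <= T ->
    sigma1 tau t < n%:R * inf (tau @` `[0, T]) ->
    x (sigma1 tau t) = y (sigma1 tau t) by move: t0; near: t.
  apply: xys; first exact: sigma1_solution_domain.
    by rewrite /sigma1 lerBlDr (le_trans tT)// lerDl ltW// tau0.
  rewrite /sigma1 ltrBlDr (lt_le_trans tn)// -natr1 mulrDl mul1r lerD2l.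
  by apply: inf_delay_le => //; rewrite t0.
(* Integer horizons suffice, and being countably many they keep the union of exceptional sets
   null. *)
have all_k k : \forall t \ae mu, D t -> t <= k%:R -> x t = y t.
  have [k0 ik0] : 0 <= k%:R :> R /\ 0 < inf (tau @` `[0, k%:R]).
    by split=> //; exact: tau_inf.
  apply: filterS (step k%:R (Num.trunc (k%:R / inf (tau @` `[0, k%:R]))).+1 k0).
  move=> t H Dt tk; apply: H => //.
  by apply: le_lt_trans tk _; rewrite -ltr_pdivrMr//; exact: truncnS_gt.
apply: filterS (ae_foralln all_k) => t H Dt.
apply: (H (Num.trunc `|t|).+1) => //.
by rewrite (le_trans (ler_norm t))// ltW// truncnS_gt.
Unshelve. all: by end_near. Qed.

(** The set where a representative [y] differs from [x] is null, and so is its preimage under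
    [sigma1]; hence [y] may replace [x] on both sides. *)
Lemma solution_ae_solution (x : R -> 'cV[R]_d) :
  (forall t, 0 <= t -> x t = A *m x (sigma1 tau t)) -> ae_solution A tau x.
Proof.
move=> xA y yx; have yxs := ae_sigma1 null ms yx.
near=> t => t0.
have -> : y t = x t.
  by move: (solution_domain_ge0 tau0 t0); near: t.
rewrite xA//; congr (_ *m _); apply/esym.
by move: (sigma1_solution_domain tau t0); move: t0; near: t.
Unshelve. all: by end_near. Qed.

Context (p : R) (p_ge1 : 1 <= p) (x0 : R -> 'cV[R]_d).
Context (x0_Lp : in_Lp p (itv_bar_o (- largest_delay tau 0)%E 0%E) x0).
Context (sigma1_le : forall T : R, 0 < T -> exists2 M : R, 0 <= M &
  forall B : set L, measurable B ->
  (mu (`[0%R, T]%classic `&` sigma1 tau @^-1` B : set L) <= M%:E * mu B)%E).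

Lemma measurable_solution_domain_le T : measurable (D `&` `]-oo, T] : set L).
Proof.
apply: measurableI; first exact: measurable_itv_bar_o.
by apply: borel_lebesgue_measurable; exact: measurable_itv.
Qed.

Lemma delay_iter_in_Lp T n : 0 < T ->
  in_Lp p (D `&` `]-oo, T]) (delay_iter A tau x0 n).
Proof.
move=> T0; have p0 : 0 < p by exact: lt_le_trans p_ge1.
elim: n => [|n IH]; first exact: in_Lp0.
have mT : measurable (`[0, T]%classic : set L).
  by apply: borel_lebesgue_measurable; exact: measurable_itv.
(* Splitting at 0 separates the part where the iterate is [x0] from the part where it is [A] times
   the previous iterate along [sigma1]. *)
have -> : D `&` `]-oo, T] =
    itv_bar_o (- largest_delay tau 0)%E 0%E `|` `[0, T]%classic.
  apply/seteqP; split=> t /=.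
    rewrite !in_itv/= => -[Dt tT]; have [t0|t0] := ltP t 0.
      by left; apply/itv_bar_o_solution_domain.
    by right; rewrite tT.
  move=> [/itv_bar_o_solution_domain[Dt t0]|]; rewrite !in_itv/=.
    by split=> //; exact/ltW/(lt_trans t0).
  by move=> /andP[t0 tT]; split=> //; exact: solution_domain_ge0.
apply: (in_LpU (measurable_itv_bar_o _ _) mT).
- apply/disj_setPS => t [[_]]; rewrite /= lte_fin in_itv/= => t0.
  by rewrite leNgt t0.
- apply: eq_in_Lp x0_Lp => t /itv_bar_o_solution_domain[_ t0].
  by rewrite /= /delay_step t0.
- have [M M0 muM] := sigma1_le T0.
  apply: (@eq_in_Lp _ _ _ _
    (fun t => A *m delay_iter A tau x0 n (sigma1 tau t))).
    by move=> t; rewrite /= in_itv/= /delay_step => /andP[t0 _]; rewrite ltNge t0.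
  apply: (@in_Lp_mulmx_comp R d p A _ _ _ (sigma1 tau : L -> L) M (ltW p0)
    (measurable_solution_domain_le T) mT _ _ M0 muM IH).
    apply: measurable_funS ms.
      by apply: borel_lebesgue_measurable; exact: measurable_itv.
    by move=> t; rewrite /= !in_itv/= andbT => /andP[].
  move=> _ [t + <-]; rewrite /= !in_itv/= => /andP[t0 tT].
  split; first exact: sigma1_solution_domain.
  by rewrite /sigma1 lerBlDr (le_trans tT)// lerDl ltW// tau0.
Qed.

Lemma delay_solution_in_Lp T : 0 < T ->
  in_Lp p (D `&` `]-oo, T]) (delay_solution A tau x0).
Proof.
move=> T0; apply: eq_in_Lp (delay_iter_in_Lp (delay_rank tau T) T0).
move=> t [_]; rewrite /= in_itv/= => tT.
by rewrite (delay_solution_rank A x0 tau0 tau_inf (ltW T0) tT (leqnn _)).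
Qed.

Lemma delay_solution_in_Lploc : in_Lploc p D (delay_solution A tau x0).
Proof.
move=> K cK KD; have [M [_ KM]] := compact_bounded cK.
(* [KM] bounds [K] by any number strictly above [M]; this one is also positive. *)
have T0 : 0 < `|M| + 1 by rewrite ltr_wpDl.
apply: (in_LpS (measurable_solution_domain_le _) _ _ (delay_solution_in_Lp T0)).
  by apply: borel_lebesgue_measurable; exact: compact_measurable.
move=> t Kt; split; first exact: KD.
rewrite /= in_itv/= (le_trans (ler_norm t))//; apply: KM => //.
by rewrite (le_lt_trans (ler_norm M))// ltrDl.
Qed.

Lemma delay_solution_LB_measurable : LB_measurable D (delay_solution A tau x0).
Proof.
rewrite /LB_measurable.
have -> : D = \bigcup_k (D `&` `]-oo, k.+1%:R] : set L).
  rewrite -setI_bigcupr; apply/esym/setIidl => t _.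
  exists (Num.trunc `|t|) => //=.
  by rewrite in_itv/= (le_trans (ler_norm t))// ltW// truncnS_gt.
apply/measurable_fun_bigcup => k; first exact: measurable_solution_domain_le.
by have [] := @delay_solution_in_Lp k.+1%:R (ltr0Sn _ _).
Qed.

End ExistenceUniqueness.

Theorem theorem4p26 (R : realType) (d : nat) (d_gt0 : (0 < d)%N)
  (A : 'M[R]_d) (p : R) (p_ge1 : 1 <= p)
  (tau : R -> R) (tau_delay : delay_function tau)
  (tau_inf : forall t, 0 <= t -> 0 < inf (tau @` `[0, t]))
  (tau_measurable :
     measurable_fun (`[0, +oo[%classic : set (lebesgueTypeR R))
                    (tau : lebesgueTypeR R -> lebesgueTypeR R))
  (sigma1_null : forall N : set (lebesgueTypeR R),
     measurable N -> completed_lebesgue_measure N = 0%E ->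
     completed_lebesgue_measure
       (`[0, +oo[ `&` sigma1 tau @^-1` N : set (lebesgueTypeR R)) = 0%E)
  (sigma1_RN : forall T : R, 0 < T ->
     bounded_RN_derivative (pushforward_on `[0, T] (sigma1 tau)))
  (x0 : R -> 'cV[R]_d)
  (x0_Lp : in_Lp p (itv_bar_c (- largest_delay tau 0)%E 0%E) x0) :
  exists x : R -> 'cV[R]_d,
    [/\ Lp_solution p A tau x,
        has_initial_condition tau x x0 &
        forall y : R -> 'cV[R]_d,
          Lp_solution p A tau y -> has_initial_condition tau y x0 ->
          y = x %[ae (@completed_lebesgue_measure R) in solution_domain tau]].
Proof.
have ms := measurable_sigma1 tau_measurable sigma1_null.
have x0_Lp' : in_Lp p (itv_bar_o (- largest_delay tau 0)%E 0%E) x0.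
  apply: in_LpS x0_Lp; [exact: measurable_itv_bar_c|exact: measurable_itv_bar_o|].
  by move=> t [? ?]; split=> //; exact: ltW.
have sigma1_le T : 0 < T -> exists2 M : R, 0 <= M &
    forall B : set (lebesgueTypeR R), measurable B ->
    (completed_lebesgue_measure (`[0%R, T]%classic `&` sigma1 tau @^-1` B :
       set (lebesgueTypeR R)) <= M%:E * completed_lebesgue_measure B)%E.
  move=> T0; apply: bounded_RN_derivative_le (sigma1_RN T T0) => N mN N0.
  (* Null sets have null image measure on [0, T] by monotonicity from [0, +oo). *)
  apply/eqP; rewrite eq_le measure_ge0 andbT -(sigma1_null N mN N0).
  apply: le_outer_measure => t [+ Nt]; rewrite /= in_itv/= => /andP[t0 _].
  by split=> //; rewrite /= in_itv/= t0.
have xA := delay_solution_ge0 A x0 tau_delay tau_inf.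
have x_init t : t < 0 -> delay_solution A tau x0 t = x0 t.
  exact: delay_solution_lt0.
have x_ae := solution_ae_solution tau_delay sigma1_null ms xA.
exists (delay_solution A tau x0); split; first split.
- exact: (delay_solution_LB_measurable A tau_delay tau_inf ms p_ge1
    x0_Lp' sigma1_le).
- exact: x_ae.
- exact: (delay_solution_in_Lploc A tau_delay tau_inf ms p_ge1
    x0_Lp' sigma1_le).
- by apply: aeW => t /itv_bar_o_solution_domain[_ /x_init].
move=> y [_ y_ae _] y_init.
apply: (delay_equation_ae_unique tau_delay tau_inf sigma1_null ms).
(* Each function is taken as its own representative in [ae_solution]. *)
- by apply: y_ae; exact: aeW.
- by apply: x_ae; exact: aeW.
- apply: filterS y_init => t yt Dt t0; rewrite x_init//.
  by apply: yt; apply/itv_bar_o_solution_domain.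
Qed.
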